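(* Let $X$ and $Y$ be topological spaces and let $X\times Y$ be equipped with a $\mathcal C$-cross topology such that the family $\mathcal C$ contains a $\pi$-network for the product topology $\tau$ on $X\times Y$. Assume that $\pi(Y)<\mathrm{add}(\mathcal M_X)$. If a set $E\subseteq X\times Y$ is open and dense with respect to the $\mathcal C$-cross topology, then there exists a meager subset $P\subseteq X$ such that for each $x\in X\setminus P$ the section $E_x=\{y\in Y:(x,y)\in E\}$ is dense in $Y$.
   Context: For $G\subseteq X\times Y$, $G_x=\{y\in Y:(x,y)\in G\}$ denotes the vertical section at $x\in X$ and $G^y=\{x\in X:(x,y)\in G\}$ the horizontal section at $y\in Y$. $\mathcal C$-cross topology: let $\mathcal C$ be a family of subsets of $X\times Y$ which is closed under finite intersections and such that for each $G\in\mathcal C$ every non-empty vertical section $G_x$ has non-empty interior in $Y$ and every non-empty horizontal section $G^y$ has non-empty interior in $X$. The $\mathcal C$-cross topology is the topology on $X\times Y$ generated by $\mathcal C$, for which $\mathcal C$ is a base. A $\pi$-network for a topology is a family of non-empty sets such that every non-empty open set contains a member of the family. A $\pi$-base is a $\pi$-network consisting of open sets. $\pi(Y)$ is the minimal cardinality of a $\pi$-base for $Y$. $\mathcal M_X$ is the $\sigma$-ideal of meager subsets of $X$. For a family $\mathcal F$ of subsets of a set $X$ with $X=\bigcup\mathcal F$, $\mathrm{add}(\mathcal F)$ is the minimal cardinality of a subfamily $\mathcal W\subseteq\mathcal F$ with $\bigcup\mathcal W\notin\mathcal F$. Writing an invariant presupposes that it is defined. Cardinal invariants are by convention assumed infinite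 (a finite value is read as $\omega$). *)

(* Defs.v *)
From HB Require Import structures.
From mathcomp Require Import all_boot all_order all_algebra.
From mathcomp Require Import all_classical all_reals all_analysis.

Set Implicit Arguments.
Unset Strict Implicit.
Unset Printing Implicit Defensive.

Local Open Scope classical_set_scope.
Local Open Scope card_scope.

Definition nowhere_dense (T : topologicalType) (A : set T) : Prop :=
  interior (closure A) = set0.

Definition meager (T : topologicalType) : set (set T) :=
  [set A | exists2 F : nat -> set T,
     (forall n, nowhere_dense (F n)) & A = \bigcup_n F n].

Definition pi_network (T : topologicalType) (N : set (set T)) : Prop :=
  (forall A, N A -> A !=set0) /\
  (forall U : set T, open U -> U !=set0 -> exists2 A, N A & A `<=` U).

Definition pi_base (T : topologicalType) (B : set (set T)) : Prop :=
  pi_network B /\ B `<=` open.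

(* Cardinals are represented by arbitrary sets [K] taken up to equipotence
   [#=]; an invariant is the predicate "[K] has the cardinality in question",
   which no [K] satisfies when the invariant is undefined. *)

Definition card_lt (T U : Type) (K : set T) (L : set U) : Prop :=
  (K #<= L) /\ ~ (L #<= K).

(* The least cardinality of a member of [FF], finite values being read as the
   first infinite cardinal. *)
Definition is_min_card (S T : Type) (FF : set (set S)) (K : set T) : Prop :=
  exists B : set S,
    [/\ FF B,
        forall B', FF B' -> B #<= B' &
        (infinite_set B /\ K #= B) \/ (finite_set B /\ K #= [set: nat])].

Definition is_pi (Y : topologicalType) (T : Type) (K : set T) : Prop :=
  is_min_card [set B : set (set Y) | pi_base B] K.

(* The first conjunct is the requirement under which [add F] is defined. *)
Definition is_add (X T : Type) (F : set (set X)) (K : set T) : Prop :=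
  \bigcup_(A in F) A = [set: X] /\
  is_min_card [set W : set (set X) | W `<=` F /\ ~ F (\bigcup_(A in W) A)] K.

(* [X * Y] with the topology generated by [C]. The topology is defined for every
   [C] by taking [C] as a subbase; that [C] is a base is part of
   [cross_family]. *)
Definition cross (X Y : topologicalType) (C : set (set (X * Y))) : Type :=
  (X * Y)%type.

HB.instance Definition _ (X Y : topologicalType) (C : set (set (X * Y))) :=
  Choice.copy (cross C) (X * Y)%type.
HB.instance Definition _ (X Y : topologicalType) (C : set (set (X * Y))) :=
  @isSubBaseTopological.Build (cross C) (set (X * Y)) C id.

Definition cross_family (X Y : topologicalType) (C : set (set (X * Y))) : Prop :=
  [/\ setI_closed C,
      (forall G, C G -> forall x : X,
         xsection G x !=set0 -> interior (xsection G x) !=set0),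
      (forall G, C G -> forall y : Y,
         ysection G y !=set0 -> interior (ysection G y) !=set0) &
      basis (C : set (set (cross C)))].

(* Main.v *)
(* For [V] in a pi-base of [Y], let [A_V] be the set of [x] whose section [E_x]
   misses [V]. If [A_V] were dense in a non-empty open [U], then [U * V] would
   contain a non-empty member of [C], which meets [E] in a non-empty cross-open
   set, which therefore contains a non-empty [W] in [C]; a horizontal section of
   [W] has interior points, and these lie in [U] but outside [A_V]. So each [A_V]
   is nowhere dense, and fewer than [add] of the meager ideal many of them have
   a meager union. *)
Require Import Defs.
From mathcomp Require Import all_boot all_order all_algebra.
From mathcomp Require Import all_classical all_reals all_analysis.
Local Open Scope classical_set_scope.

Lemma nowhere_dense_meager (X : topologicalType) (A : set X) :
  nowhere_dense A -> meager A.
Proof. by move=> ndA; exists (fun=> A) => //; rewrite bigcup_const. Qed.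

Lemma open_setX (X Y : topologicalType) (U : set X) (V : set Y) :
  open U -> open V -> open (U `*` V).
Proof.
move=> oU oV; rewrite openE => -[x y] [/= Ux Vy].
by exists (U, V) => //; split; exact: open_nbhs_nbhs.
Qed.

Lemma nowhere_dense_xsection_miss (X Y : topologicalType)
    (C : set (set (X * Y))) (E : set (X * Y)) (V : set Y) :
  cross_family C ->
  (exists2 N : set (set (X * Y)), pi_network N & N `<=` C) ->
  open (E : set (cross C)) -> dense (E : set (cross C)) ->
  open V -> V !=set0 ->
  nowhere_dense [set x | ~ (V `&` xsection E x !=set0)].
Proof.
move=> [_ _ hy [Co Cb]] [N [N0 NU] NC] oE dE oV [v Vv].
set A := [set x | _]; apply: contrapT => /eqP /set0P [u Au].
(* The open set in which [A] is dense is taken to be the interior of its closure, non-empty by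
   contradiction. *)
have [G NG GAV] : exists2 G, N G & G `<=` (closure A)^° `*` V.
  apply: NU; last by exists (u, v).
  exact: open_setX (open_interior _) oV.
have oG : open (G : set (cross C)) by apply/Co/NC.
have [p [Gp Ep]] := dE G (N0 _ NG) oG.
have [W [CW Wp] WGE] : exists2 W, C W /\ W p & W `<=` G `&` E.
  apply: (Cb p (G `&` E)).
  by apply: open_nbhs_nbhs; split; [exact: openI|].
case: p Gp Ep Wp => x y Gp Ep Wp.
have [x' ix'] : (ysection W y)^° !=set0.
  by apply: hy => //; exists x; apply/ysectionP.
have WE z : ysection W y z -> G (z, y) /\ E (z, y).
  by move=> /ysectionP /WGE.
(* [x'] is only known to lie in the closure of [A]; as [ysection W y] is a neighbourhood of [x'], it
   contains some [z] in [A] itself, and [y] then witnesses that the section of [E] at [z] meets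
   [V]. *)
have [/GAV [/interior_subset/= clx' _] _] := WE _ (interior_subset ix').
have [z [Az /WE [/GAV [_ /= Vy] Ez]]] := clx' _ ix'.
by apply: Az; exists y; split=> //; apply/xsectionP.
Qed.

(** Otherwise the image of [B] under [f] competes in the minimum defining the additivity of [F]; if
    that minimum is infinite, then [L #<= B #<= K], against [card_lt K L]. *)
Lemma bigcup_lt_add (X I S T : Type) (F : set (set X)) (B : set I)
    (f : I -> set X) (K : set S) (L : set T) :
  is_add F L -> (B #<= K)%card -> infinite_set K -> card_lt K L ->
  (forall i, B i -> F (f i)) -> F (\bigcup_(i in B) f i).
Proof.
move=> [_ [W [_ Wmin WL]]] BK infK [_ KL] Ff; apply: contrapT => nF.
apply: KL; case: WL => [[_ LW]|[_ Lnat]]; last first.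
  (* A finite minimum is read as [nat], which embeds in the infinite [K]. *)
  by rewrite (card_le_eql Lnat); apply/infiniteP.
rewrite (card_le_eql LW); apply: card_le_trans BK.
apply: card_le_trans (card_image_le f B); apply: Wmin.
by rewrite /= bigcup_image; split=> // _ [i Bi <-]; exact: Ff.
Qed.

(** Equipotence of [B] and [K] weakens to [#<=] because a finite minimiser is assigned the cardinal
    of [nat]. *)
Lemma is_min_card_infinite (S T : Type) (FF : set (set S)) (K : set T) :
  is_min_card FF K ->
  infinite_set K /\ exists2 B, FF B & (B #<= K)%card.
Proof.
move=> [B [FB _ [[infB KB]|[finB Knat]]]].
  split; last by exists B => //; rewrite (card_le_eqr KB).
  by apply/infiniteP; rewrite (card_le_eqr KB); apply/infiniteP.
split; first by apply/infiniteP; rewrite (card_le_eqr Knat).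
by exists B => //; rewrite (card_le_eqr Knat); exact: finite_set_countable.
Qed.

Theorem theorem2 (X Y : topologicalType) (C : set (set (X * Y)))
    (hC : cross_family C)
    (hN : exists2 N : set (set (X * Y)), pi_network N & N `<=` C)
    (S T : Type) (K : set S) (L : set T)
    (hK : is_pi Y K) (hL : is_add (@meager X) L) (hKL : card_lt K L)
    (E : set (X * Y))
    (oE : open (E : set (cross C))) (dE : dense (E : set (cross C))) :
  exists2 P : set X, meager P & forall x, ~ P x -> dense (xsection E x).
Proof.
have [infK [B [[B0 BU] oB] BK]] := @is_min_card_infinite _ _ _ _ hK.
exists (\bigcup_(V in B) [set x | ~ (V `&` xsection E x !=set0)]).
  apply: bigcup_lt_add hL BK infK hKL _ => V BV.
  apply: nowhere_dense_meager.
  exact: nowhere_dense_xsection_miss hC hN oE dE (oB _ BV) (B0 _ BV).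
(* Density need only be tested on the pi-base: a section meeting [V] also meets every [O] containing
   [V]. *)
move=> x Px O O0 oO; have [V BV VO] := BU O oO O0.
have /contrapT [y [Vy Ey]] : ~ ~ (V `&` xsection E x !=set0).
  by move=> nV; apply: Px; exists V.
by exists y; split=> //; exact: VO.
Qed.
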